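(* Let $r\ge 2$ and let $G$ and $H$ be graphs. Then, as $t\to\infty$, $$R_r(G,H;t)\ \ge\ \bigl(1+o(1)\bigr)\bigl(r^{d(H)/v(H)}e^{-1}\bigr)\, t\, r^{d(H)t/2}.$$
   Context: $d(H)=2e(H)/v(H)$ is the average degree of $H$. For a graph $G$ with vertices $v_1,\dots,v_m$, the $n$-blowup $G[n]$ replaces each $v_i$ by an independent set $U_i$ of $n$ vertices and puts a complete bipartite graph between $U_i$ and $U_j$ for every edge $v_iv_j$. A copy of $H[t]$ in $G[n]$ is canonical if there is a copy $H'$ of $H$ in $G$ and sets $S_i\subseteq U_i$, $|S_i|=t$, for each vertex $v_i$ of $H'$, with the copy consisting of $\bigcup S_i$ and all edges between $S_i,S_j$ for edges $v_iv_j$ of $H'$. $G[n]$ is canonically $r$-Ramsey for $H[t]$ if every $r$-colouring of the edges of $G[n]$ contains a monochromatic canonical copy of $H[t]$. The blowup Ramsey number is $R_r(G,H;t)=\min\{n: G[n]\text{ is canonically } r\text{-Ramsey for } H[t]\}$ (infinite if no such $n$ exists). *)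

(* Defs.v *)
From HB Require Import structures.
From mathcomp Require Import all_boot all_order all_algebra.
From mathcomp Require Import all_classical all_reals all_analysis.

Set Implicit Arguments.
Unset Strict Implicit.
Unset Printing Implicit Defensive.

Import Order.TTheory GRing.Theory Num.Theory.
Import numFieldNormedType.Exports.

Record sgraph := SGraph {
  vertex :> finType;
  adj : rel vertex;
  adj_sym : symmetric adj;
  adj_irrefl : irreflexive adj
}.

Definition edges (G : sgraph) : {set {set G}} :=
  [set [set p.1; p.2] | p in [pred p : G * G | adj p.1 p.2]].

Definition nv (G : sgraph) : nat := #|G|.
Definition ne (G : sgraph) : nat := #|edges G|.

Definition avg_degree (R : realType) (G : sgraph) : R :=
  (2 * (ne G)%:R / (nv G)%:R)%R.

Record subgraph (G : sgraph) := Subgraph {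
  sub_verts : {set G};
  sub_edges : {set {set G}};
  sub_edgesP : sub_edges \subset edges G;
  sub_endsP : forall e, e \in sub_edges -> e \subset sub_verts
}.

(* Copies are subgraphs isomorphic to H, not necessarily induced. *)
Definition is_copy (H G : sgraph) (K : subgraph G) : Prop :=
  exists f : H -> G,
    [/\ injective f,
        sub_verts K = [set f v | v in H] &
        sub_edges K = [set [set f v | v in e] | e : {set H} in edges H]].

Definition blowup_adj (G : sgraph) (n : nat) : rel (G * 'I_n) := fun x y => adj x.1 y.1.

Lemma blowup_adj_sym (G : sgraph) (n : nat) : symmetric (@blowup_adj G n).
Proof. by move=> x y; rewrite /blowup_adj adj_sym. Qed.

Lemma blowup_adj_irrefl (G : sgraph) (n : nat) :
  irreflexive (@blowup_adj G n).
Proof. by move=> x; rewrite /blowup_adj adj_irrefl. Qed.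

Definition blowup (G : sgraph) (n : nat) : sgraph :=
  SGraph (@blowup_adj_sym G n) (@blowup_adj_irrefl G n).

Definition part (G : sgraph) (n : nat) (v : G) : {set blowup G n} :=
  [set x : G * 'I_n | x.1 == v].

Definition is_canonical_copy (H G : sgraph) (t n : nat)
    (K : subgraph (blowup G n)) : Prop :=
  exists (H' : subgraph G) (S : G -> {set blowup G n}),
    [/\ is_copy H H',
        forall v, v \in sub_verts H' -> S v \subset part n v /\ #|S v| = t,
        sub_verts K = \bigcup_(v in sub_verts H') S v &
        forall e, e \in sub_edges K <->
          exists u v x y, [/\ [set u; v] \in sub_edges H',
            x \in S u, y \in S v & e = [set x; y]]].

(* Only the values of a colouring on the edges matter. *)
Definition monochromatic (G : sgraph) (r : nat) (col : {set G} -> 'I_r)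
    (K : subgraph G) : Prop :=
  exists c : 'I_r, forall e, e \in sub_edges K -> col e = c.

Definition canonically_ramsey (r : nat) (G H : sgraph) (t n : nat) : Prop :=
  forall col : {set blowup G n} -> 'I_r,
    exists K : subgraph (blowup G n),
      is_canonical_copy H t K /\ monochromatic col K.

Definition blowup_ramsey (R : realType) (r : nat) (G H : sgraph) (t : nat)
    : \bar R :=
  if pselect (exists n, `[< canonically_ramsey r G H t n >]) is left ex
  then ((ex_minn ex)%:R%R)%:E
  else +oo%E.

(* Main.v *)
(** If [n] is canonically Ramsey, then no colouring of the edges of [G[n]] avoids
    the hypergraph whose hyperedges are the edge sets of the canonical copies of
    [H[t]], each of size at least [s = e(H) t^2].  A plain union bound misses the
    factor [r^(d(H)/v(H))]; it is recovered by exploiting that an edge [x] fixes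
    two vertices of every copy through it, so that [x] lies in only
    [D = O((t/n)^2 C(n,t)^v(H))] hyperedges.  A local-lemma type statement
    (no monochromatic hyperedge as soon as [4 s D <= r^(s-1)]) then gives
    [n^(v(H)t-2) >= t!^v(H) r^(e(H)t^2) / O(t^4)], and taking logarithms yields
    the claim.  The local lemma is replaced by Rosenfeld's counting argument:
    each new point imposed keeps a proportion at least [1 - 1/(2s)] of the
    colourings that are proper so far. *)

Require Import Defs.
From mathcomp Require Import all_boot all_order all_algebra lra ring zify.

Set Implicit Arguments.
Unset Strict Implicit.
Unset Printing Implicit Defensive.

Import Order.TTheory GRing.Theory Num.Theory.

(** * Colourings without monochromatic hyperedges *)

Section HypergraphColouring.
Variables (T : finType) (r : nat).
Implicit Types (S F : {set T}) (col : {ffun T -> 'I_r}) (P : {set {ffun T -> 'I_r}}).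

Definition mono col F := [exists c, [forall x in F, col x == c]].

(** Each of the [r] colours freezes the values on [F] and leaves the other points free; the product
    form avoids division. *)
Lemma card_mono F : #|[set col | mono col F]| * r ^ #|F| <= r * r ^ #|T|.
Proof.
have card_const c :
    #|[set col : {ffun T -> 'I_r} | [forall x in F, col x == c]]| * r ^ #|F| = r ^ #|T|.
  have -> : #|[set col : {ffun T -> 'I_r} | [forall x in F, col x == c]]| =
            #|family (fun x => [pred y | (x \in F) ==> (y == c)])|.
    apply: eq_card => col; rewrite !inE; apply/forallP/forallP => h x; have := h x;
    by rewrite !inE.
  rewrite card_family foldrE big_image /= (bigID (mem F)) /=.
  rewrite big1 => [|x xF]; last first.
    by rewrite -(card1 c); apply: eq_card => y; rewrite !inE xF.
  rewrite (eq_bigr (fun=> r)) => [|x xF]; last first.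
    by transitivity #|'I_r|; [apply: eq_card => y; rewrite !inE (negbTE xF) | exact: card_ord].
  rewrite mul1n prod_nat_const -expnD addnC.
  by congr (r ^ _); rewrite -(cardC (mem F)).
have le_sum : #|[set col | mono col F]| <=
    \sum_(c < r) #|[set col : {ffun T -> 'I_r} | [forall x in F, col x == c]]|.
  have -> : [set col | mono col F] =
      \bigcup_(c < r) [set col : {ffun T -> 'I_r} | [forall x in F, col x == c]].
    apply/setP => col; rewrite !inE; apply/existsP/bigcupP => [[c hc]|[c _]].
      by exists c; rewrite ?inE.
    by rewrite inE => hc; exists c.
  elim/big_rec2: _ => [|c m A _ IH]; first by rewrite cards0.
  by rewrite (leq_trans (leq_card_setU _ _).1) // leq_add2l.
apply: leq_trans (leq_mul le_sum (leqnn _)) _.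
rewrite big_distrl /= (eq_bigr (fun=> r ^ #|T|)) => [|c _]; last exact: card_const.
by rewrite sum_nat_const card_ord.
Qed.

(* Exchanging the values on [F] of two colourings maps (mono on F) x (all)
   injectively into (all) x (mono on F), and preserves [P]. *)
Lemma card_mono_independent P F :
    (forall col col', {in ~: F, col =1 col'} -> col \in P -> col' \in P) ->
  #|[set col in P | mono col F]| * r ^ #|F| <= r * #|P|.
Proof.
move=> indepP.
pose swap (p : {ffun T -> 'I_r} * {ffun T -> 'I_r}) :=
  ([ffun x => if x \in F then p.2 x else p.1 x],
   [ffun x => if x \in F then p.1 x else p.2 x]).
have swapK : involutive swap.
  by case=> a b; congr pair; apply/ffunP => x; rewrite !ffunE /=; case: (x \in F).
have sub : [set swap p | p in setX [set col in P | mono col F] setT]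
    \subset setX P [set col | mono col F].
  apply/subsetP => _ /imsetP[[a b] + ->]; rewrite !inE /= andbT => /andP[Pa].
  case/existsP=> c /forall_inP hc; apply/andP; split.
    apply: indepP Pa => x; rewrite inE => /negbTE xF; by rewrite ffunE xF.
  by apply/existsP; exists c; apply/forall_inP => x xF; rewrite ffunE xF hc.
have := subset_leq_card sub; rewrite (card_imset _ (inv_inj swapK)) !cardsX.
rewrite cardsT card_ffun card_ord => le1.
have le2 := card_mono F.
case: (posnP r) => [r0|r_gt0].
  suff -> : [set col in P | mono col F] = set0 by rewrite cards0.
  apply/setP => col; rewrite !inE; apply/negP => /andP[_ /existsP[[c hc] _]].
  by exfalso; rewrite r0 in hc.
have rT : 0 < r ^ #|T| by rewrite expn_gt0 r_gt0.
rewrite -(leq_pmul2r rT).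
rewrite -mulnA [X in _ * X]mulnC mulnA (leq_trans (leq_mul le1 (leqnn _))) //.
rewrite -mulnA (leq_trans (leq_mul (leqnn _) le2)) //.
by rewrite mulnA leq_mul2r [_ * r]mulnC leqnn orbT.
Qed.

(** * Rosenfeld's counting of proper colourings *)

Variable FF : {set {set T}}.

(** All of [T] is coloured but only hyperedges inside [S] are tested, so counts for different [S]
    are comparable. *)
Definition proper_on S : {set {ffun T -> 'I_r}} :=
  [set col : {ffun T -> 'I_r} | [forall F in FF, (F \subset S) ==> ~~ mono col F]].

Lemma proper_onP S col :
  reflect (forall F, F \in FF -> F \subset S -> ~~ mono col F) (col \in proper_on S).
Proof.
rewrite inE; apply: (iffP forall_inP) => h F FFF; first by move/implyP: (h F FFF).
by apply/implyP; apply: h.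
Qed.

Lemma proper_on_sub S S' : S \subset S' -> proper_on S' \subset proper_on S.
Proof.
move=> sub; apply/subsetP => col /proper_onP h; apply/proper_onP => F FFF FS.
by apply: h => //; apply: subset_trans sub.
Qed.

Lemma proper_on_eq S col col' :
  {in S, col =1 col'} -> col \in proper_on S -> col' \in proper_on S.
Proof.
move=> eqc /proper_onP h; apply/proper_onP => F FFF FS.
apply: contra (h F FFF FS) => /existsP[c /forall_inP hc].
apply/existsP; exists c; apply/forall_inP => x xF.
by rewrite eqc ?hc // (subsetP FS).
Qed.

(** A loss is caused by a monochromatic [F] through [x]. Properness is weakened from [S] to
    [S :\: F] so that it no longer depends on the colours on [F]. *)
Lemma proper_on_step S x :
  (#|proper_on S| <= #|proper_on (x |: S)| +
    \sum_(F in FF | (x \in F) && (F \subset x |: S))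
      #|[set col in proper_on (S :\: F) | mono col F]|)%N.
Proof.
set B := fun F => [set col in proper_on (S :\: F) | mono col F].
have sub : proper_on S \subset proper_on (x |: S) :|:
    \bigcup_(F in FF | (x \in F) && (F \subset x |: S)) B F.
  apply/subsetP => col cS; rewrite inE -implyNb; apply/implyP.
  rewrite [in X in ~~ X -> _]inE negb_forall_in => /exists_inP[F FFF].
  rewrite negb_imply negbK => /andP[FS mF]; apply/bigcupP; exists F.
    rewrite FFF FS andbT /=; apply/negPn/negP => xF.
    move/proper_onP: cS => /(_ F FFF) h; move: mF; apply/negP; apply: h.
    apply/subsetP => y yF; move/subsetP: FS => /(_ y yF); rewrite !inE => /orP[/eqP yx|//].
    by move: xF; rewrite -yx yF.
  by rewrite inE mF andbT (subsetP (proper_on_sub (subsetDl S F))).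
apply: leq_trans (subset_leq_card sub) _.
apply: leq_trans (leq_card_setU _ _).1 _; rewrite leq_add2l.
elim/big_rec2: _ => [|F m A _ IH]; first by rewrite cards0.
by rewrite (leq_trans (leq_card_setU _ _).1) // leq_add2l.
Qed.

Local Open Scope ring_scope.

(* Rosenfeld's counting argument: adding a point to [S] keeps at least a
   proportion [g] of the proper colourings, by induction on [S]. *)
Lemma proper_on_growth (R : realFieldType) (g D : R) (s : nat) :
    (0 < r)%N -> 0 < g -> 1 <= r%:R * g ->
    D <= (1 - g) * (r%:R * g) ^+ s ->
    (forall F, F \in FF -> (s < #|F|)%N) ->
    (forall x, #|[set F in FF | x \in F]|%:R <= D) ->
  forall S x, g * #|proper_on S|%:R <= #|proper_on (x |: S)|%:R.
Proof.
move=> r_gt0 g_gt0 rg_ge1 hD big deg S.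
have rR : 0 < r%:R :> R by rewrite ltr0n.
have deg_ge0 (x : T) : 0 <= D by apply: le_trans (deg x); rewrite ler0n.
have g_le1 (x : T) : g <= 1.
  have := le_trans (deg_ge0 x) hD; rewrite pmulr_lge0 ?subr_ge0 //.
  by rewrite exprn_gt0 // mulr_gt0.
have [m] := ubnP #|S|; elim: m S => // m IH S Sm x.
case: (boolP (x \in S)) => [xS|xS].
  have -> : x |: S = S by apply/setUidPr; rewrite sub1set.
  by rewrite ler_piMl ?ler0n ?g_le1.
(* The points of [A] are put back one at a time, each at the cost of a factor [g] by induction. *)
have iter (A : {set T}) : A \subset S ->
    g ^+ #|A| * #|proper_on (S :\: A)|%:R <= #|proper_on S|%:R.
  have [k] := ubnP #|A|; elim: k A => // k IHk A Ak AS.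
  case: (set_0Vmem A) => [->|[y yA]]; first by rewrite cards0 mul1r setD0.
  rewrite (cardsD1 y) yA exprS.
  have AyS : A :\ y \subset S by apply: subset_trans AS; apply: subsetDl.
  apply: le_trans (IHk (A :\ y) _ AyS); last first.
    by move: Ak; rewrite (cardsD1 y A) yA; lia.
  rewrite -mulrA mulrCA ler_wpM2l ?exprn_ge0 ?(ltW g_gt0) //.
  have -> : S :\: (A :\ y) = y |: (S :\: A).
    apply/setP => z; rewrite !inE; case: eqP => [->|] //=.
    by rewrite (subsetP AS).
  apply: IH; rewrite -ltnS; apply: leq_trans Sm; rewrite ltnS.
  by apply: proper_card; apply/properP; split; [exact: subsetDl|];
    exists y; rewrite ?inE ?yA ?(subsetP AS).
have step := proper_on_step S x.
(* Only the [#|F| - 1] points other than [x] come out of [S], while [F] is [mono] with probability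
   at most [r ^ (1 - #|F|)]. As [r * g >= 1], the exponent may drop to [s]. *)
have bound F : F \in FF -> (x \in F) && (F \subset x |: S) ->
    #|[set col in proper_on (S :\: F) | mono col F]|%:R * (r%:R * g) ^+ s <= #|proper_on S|%:R.
  move=> FFF /andP[xF FS].
  have cF := big F FFF.
  have eqF : #|F| = #|F :\ x|.+1 by rewrite (cardsD1 x) xF.
  have eqD : S :\: (F :\ x) = S :\: F.
    by apply/setP => z; rewrite !inE; case: eqP => [->|] //=; rewrite (negbTE xS) andbF.
  have FxS : F :\ x \subset S by rewrite subDset.
  apply: le_trans (iter _ FxS); rewrite eqD.
  apply: (@le_trans _ _ (#|[set col in proper_on (S :\: F) | mono col F]|%:R
                          * (r%:R * g) ^+ #|F :\ x|)).
    rewrite ler_wpM2l ?ler0n // ler_weXn2l //; lia.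
  rewrite exprMn mulrA mulrC ler_wpM2l ?exprn_ge0 ?(ltW g_gt0) //.
  have := @card_mono_independent (proper_on (S :\: F)) F.
  rewrite eqF expnS mulnCA leq_pmul2l // => h.
  rewrite -natrX -natrM ler_nat; apply: h => col col' eqc; apply: proper_on_eq => z.
  by rewrite inE => /andP[zF _]; apply: eqc; rewrite inE.
have rgs : 0 < (r%:R * g) ^+ s by rewrite exprn_gt0 // mulr_gt0.
(* At most [D] hyperedges pass through [x], so [hD] bounds the total loss by the fraction
   [1 - g]. *)
have : (\sum_(F in FF | (x \in F) && (F \subset x |: S))
      #|[set col in proper_on (S :\: F) | mono col F]|)%:R <= (1 - g) * #|proper_on S|%:R :> R.
  rewrite -(ler_pM2r rgs) natr_sum mulr_suml.
  apply: (@le_trans _ _ (\sum_(F in FF | (x \in F) && (F \subset x |: S)) #|proper_on S|%:R)).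
    by apply: ler_sum => F /andP[FFF hF]; apply: bound.
  rewrite sumr_const -[X in X <= _]mulr_natl mulrAC ler_wpM2r ?ler0n //.
  apply: le_trans hD; apply: le_trans (deg x); rewrite ler_nat.
  by apply: subset_leq_card; apply/subsetP => F; rewrite !inE => /andP[-> /andP[-> _]].
rewrite mulrBl mul1r => bad; move: step; rewrite -(ler_nat R) natrD -lerBlDr.
by apply: le_trans; rewrite lerBrDl addrC -lerBrDl.
Qed.

(** On the empty set every colouring is proper, since hyperedges are nonempty; growth then keeps the
    count positive up to all of [T]. *)
Lemma exists_proper_colouring (R : realFieldType) (g D : R) (s : nat) :
    (0 < r)%N -> 0 < g -> 1 <= r%:R * g ->
    D <= (1 - g) * (r%:R * g) ^+ s ->
    (forall F, F \in FF -> (s < #|F|)%N) ->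
    (forall x, #|[set F in FF | x \in F]|%:R <= D) ->
  exists col, forall F, F \in FF -> ~~ mono col F.
Proof.
move=> r_gt0 g_gt0 rg_ge1 hD big deg.
have growth := proper_on_growth r_gt0 g_gt0 rg_ge1 hD big deg.
have pos S : (0 < #|proper_on S|)%N.
  have [m] := ubnP #|S|; elim: m S => // m IH S Sm.
  case: (set_0Vmem S) => [->|[y yS]].
    apply/card_gt0P; exists [ffun=> Ordinal r_gt0]; apply/proper_onP => F FFF.
    by rewrite subset0 => /eqP F0; have := big F FFF; rewrite F0 cards0.
  rewrite -(setD1K yS) -(ltr0n R); apply: lt_le_trans (growth _ _).
  rewrite mulr_gt0 // ltr0n IH //; move: Sm; rewrite (cardsD1 y S) yS; lia.
have /card_gt0P[col /proper_onP h] := pos [set: T].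
by exists col => F FFF; apply: h; rewrite ?subsetT.
Qed.

(* The choice [g = 1 - 1 / (2 s + 2)] in the growth lemma, with Bernoulli's
   inequality giving [g ^+ s >= 1 / 2]. *)
Lemma exists_proper_colouring_degree (R : realFieldType) (D : R) (s : nat) :
    (1 < r)%N ->
    4 * s.+1%:R * D <= r%:R ^+ s ->
    (forall F, F \in FF -> (s < #|F|)%N) ->
    (forall x, #|[set F in FF | x \in F]|%:R <= D) ->
  exists col, forall F, F \in FF -> ~~ mono col F.
Proof.
move=> r_gt1 hD big deg.
pose u : R := (2 * s.+1%:R)^-1; pose g := 1 - u.
have s_gt0 : 0 < s.+1%:R :> R by rewrite ltr0n.
have uE : 2 * s.+1%:R * u = 1 by rewrite divff // mulf_neq0 ?pnatr_eq0.
have u_gt0 : 0 < u by rewrite invr_gt0 mulr_gt0.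
have s1 : 1 <= s.+1%:R :> R by rewrite ler1n.
have u_le : u <= 1 / 2 by nra.
have g_ge : 1 / 2 <= g by rewrite /g; lra.
have r2 : 2 <= r%:R :> R by rewrite (ler_nat R 2).
have bernoulli k : 1 - k%:R * u <= g ^+ k.
  elim: k => [|k IH]; first by rewrite mul0r subr0.
  rewrite exprSr; have g0 : 0 <= g by lra.
  apply: le_trans (ler_wpM2r g0 IH); rewrite -natr1 /g.
  have : 0 <= k%:R :> R by rewrite ler0n.
  nra.
have rg_ge1 : 1 <= r%:R * g.
  by apply: (@le_trans _ _ (2 * g)); [lra | rewrite ler_pM2r //; lra].
apply: (@exists_proper_colouring R g D s) => //; [lia | lra |].
have hg : 1 / 2 <= g ^+ s.
  apply: le_trans (bernoulli s); move: uE; rewrite -[s.+1%:R]natr1; lra.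
rewrite exprMn {1}/g opprB addrC subrK.
have rs : 0 < r%:R ^+ s :> R by rewrite exprn_gt0 //; lra.
(* As [2 * (s + 1) * u = 1], the hypothesis becomes [D <= r ^ s * u / 2], and [g ^ s >= 1 / 2]
   absorbs the half. *)
have DE : D = (4 * s.+1%:R * D) * (u / 2).
  have -> : 4 * s.+1%:R * D * (u / 2) = (2 * s.+1%:R * u) * D by field.
  by rewrite uE mul1r.
rewrite DE; apply: (@le_trans _ _ (r%:R ^+ s * (u / 2))).
  by rewrite ler_wpM2r //; lra.
by rewrite mulrCA !ler_pM2l //; lra.
Qed.

End HypergraphColouring.

(** * Canonical copies in a blowup *)

Lemma set2_inj (T : finType) (u v a b : T) :
  a != b -> [set u; v] = [set a; b] -> (u = a /\ v = b) \/ (u = b /\ v = a).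
Proof.
move=> ab E.
have : u \in [set a; b] by rewrite -E set21.
have : v \in [set a; b] by rewrite -E set22.
have : a \in [set u; v] by rewrite E set21.
have : b \in [set u; v] by rewrite E set22.
move/eqP: ab => ab; rewrite !inE.
by do 4!case/orP=> /eqP ?; intuition congruence.
Qed.

Lemma edgesP (G : sgraph) (e : {set G}) :
  reflect (exists a b, adj a b /\ e = [set a; b]) (e \in edges G).
Proof.
apply: (iffP imsetP) => [[[a b] /= ab ->]|[a [b [ab ->]]]]; first by exists a, b.
by exists (a, b).
Qed.

Lemma adj_neq (G : sgraph) (a b : G) : adj a b -> a != b.
Proof. by apply: contraTneq => ->; rewrite adj_irrefl. Qed.

(** Removing the [t]-sets that avoid [i] leaves ['C(n.-1, t.-1)] sets, by Pascal's rule. *)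
Lemma card_draws_mem n t (i : 'I_n) :
  0 < t -> n * #|[set s : {set 'I_n} | (#|s| == t) && (i \in s)]| = t * 'C(n, t).
Proof.
case: t => // t _; rewrite -mul_bin_diag; congr (_ * _).
have := card_draws 'I_n t.+1; rewrite card_ord.
rewrite -(cardsID [set s : {set 'I_n} | i \in s]).
have -> : [set A : {set 'I_n} | #|A| == t.+1] :&: [set s : {set 'I_n} | i \in s] =
          [set s : {set 'I_n} | (#|s| == t.+1) && (i \in s)].
  by apply/setP => s; rewrite !inE.
have -> : [set A : {set 'I_n} | #|A| == t.+1] :\: [set s : {set 'I_n} | i \in s] =
          [set A : {set 'I_n} | A \subset ~: [set i] & #|A| == t.+1].
  by apply/setP => s; rewrite !inE subsetC sub1set inE.
rewrite cards_draws cardsC1 card_ord => eqb.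
have n_gt0 : 0 < n by case: (i) => m; apply: leq_ltn_trans.
have := binS n.-1 t; rewrite prednK //; lia.
Qed.

Lemma ffact_le_exp n m : n ^_ m <= n ^ m.
Proof.
elim: m n => [|m IH] n //; rewrite ffactnS expnS leq_mul //.
by apply: leq_trans (IH _) _; case: m {IH} => // m; rewrite leq_exp2r // leq_pred.
Qed.

Section CanonicalCopies.
Variables (G H : sgraph) (n t : nat).
Implicit Types (f : {ffun H -> G}) (S : {ffun H -> {set 'I_n}}).

Definition blowup_edge (u v : G) (i j : 'I_n) : {set blowup G n} :=
  [set ((u, i) : blowup G n); ((v, j) : blowup G n)].

(** Index sets are attached to vertices of [H] rather than of [G], so a canonical copy is encoded by
    two finite functions, which can be counted. *)
Definition lift_edges f S : {set {set blowup G n}} :=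
  [set e | [exists a, exists b, exists i in S a, exists j in S b,
     adj a b && (e == blowup_edge (f a) (f b) i j)]].

Lemma lift_edgesP f S (e : {set blowup G n}) :
  reflect (exists a b i j, [/\ adj a b, i \in S a, j \in S b &
                               e = blowup_edge (f a) (f b) i j])
    (e \in lift_edges f S).
Proof.
rewrite inE; apply: (iffP existsP) => [[a]|[a [b [i [j [ab ia jb ->]]]]]].
  case/existsP=> b /exists_inP[i ia] /exists_inP[j jb] /andP[ab /eqP ->].
  by exists a, b, i, j.
exists a; apply/existsP; exists b; apply/exists_inP; exists i => //.
by apply/exists_inP; exists j; rewrite ?ab /=.
Qed.

Lemma blowup_edge_inj (u v u' v' : G) i j i' j' :
  u != v -> blowup_edge u' v' i' j' = blowup_edge u v i j ->
  (i' = i /\ j' = j) \/ (i' = j /\ j' = i).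
Proof.
move=> uv /set2_inj[|[[_ ->] [_ ->]]|[[_ ->] [_ ->]]]; [|by left|by right].
by apply: contra uv => /eqP[->].
Qed.

Lemma blowup_edge_inj2 (u v : G) i j i' j' :
  u != v -> blowup_edge u v i' j' = blowup_edge u v i j -> i' = i /\ j' = j.
Proof.
move=> uv /set2_inj[|[[->] [->]]|[[uv' _] _]]; [|by []|by rewrite uv' eqxx in uv].
by apply: contra uv => /eqP[->].
Qed.

Lemma canonical_copy_lift_edges (K : subgraph (blowup G n)) :
  is_canonical_copy H t K ->
  exists f S, [/\ injective f, forall a, #|S a| = t & sub_edges K = lift_edges f S].
Proof.
case=> H' [S [[f [f_inj vE eE]] hS _ hK]].
have fv a : f a \in sub_verts H' by rewrite vE imset_f.
pose s := [ffun a : H => [set i : 'I_n | (f a, i) \in S (f a)]].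
exists (finfun f), s; split.
- by move=> a b; rewrite !ffunE; apply: f_inj.
- move=> a; have [/subsetP Sp <-] := hS _ (fv a).
  rewrite ffunE -(card_imset _ (_ : injective (fun i : 'I_n => (f a, i)))).
    2: by move=> i j [].
  apply: eq_card => -[u i]; apply/imsetP/idP => [[j + ->]|uS]; first by rewrite inE.
  have := Sp _ uS; rewrite inE /= => /eqP uE; exists i; rewrite ?uE // inE -uE //.
  by rewrite uE in uS *.
apply/setP => e; apply/idP/lift_edgesP.
  case/hK=> u [v [x [y [+ xS yS ->]]]].
  rewrite eE => /imsetP[_ /edgesP[a [b [ab ->]]]]; rewrite imsetU !imset_set1.
  have fab : f a != f b by rewrite (inj_eq f_inj) adj_neq.
  have wit c d : adj c d -> u = f c -> v = f d ->
      exists a b i j, [/\ adj a b, i \in s a, j \in s b &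
        [set x; y] = blowup_edge (finfun f a) (finfun f b) i j].
    move=> cd uE vE'; move: xS yS; rewrite uE vE' => xS yS.
    have [/subsetP/(_ _ xS) + _] := hS _ (fv c); have [/subsetP/(_ _ yS) + _] := hS _ (fv d).
    case: x y xS yS => [x i] [y j] xS yS; rewrite !inE /= => /eqP yE /eqP xE.
    by exists c, d, i, j; rewrite !ffunE !inE /blowup_edge -xE -yE in xS yS *; split;
      rewrite // ?xE ?yE // -?xE -?yE.
  by case/(set2_inj fab)=> -[]; apply: wit => //; rewrite adj_sym.
case=> a [b [i [j [ab + + ->]]]]; rewrite /s !ffunE !inE => ia jb.
apply/hK; exists (f a), (f b), (f a, i), (f b, j); split=> //.
rewrite eE; apply/imsetP; exists [set a; b]; first by apply/edgesP; exists a, b.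
by rewrite imsetU !imset_set1.
Qed.

(** Projecting to [H] splits the edges into fibres over [edges H]; each fibre contains the [t ^ 2]
    pairs from [S a] and [S b]. *)
Lemma card_lift_edges f S :
  injective f -> (forall a, #|S a| = t) -> ne H * t ^ 2 <= #|lift_edges f S|.
Proof.
move=> f_inj cS.
pose base (x : {set blowup G n}) : {set H} := [set a | f a \in [set p.1 | p in x]].
have baseE a b i j : base (blowup_edge (f a) (f b) i j) = [set a; b].
  apply/setP => c; rewrite inE /blowup_edge imsetU !imset_set1 /= !inE.
  by rewrite !(inj_eq f_inj).
rewrite -[#|lift_edges f S|]sum1_card (partition_big base (mem (edges H))) /=; last first.
  move=> _ /lift_edgesP[a [b [i [j [ab _ _ ->]]]]]; rewrite baseE.
  by apply/edgesP; exists a, b.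
rewrite /ne -sum_nat_const; apply: leq_sum => _ /edgesP[a [b [ab ->]]].
rewrite sum1_card.
pose pr (p : 'I_n * 'I_n) := blowup_edge (f a) (f b) p.1 p.2.
have fab : f a != f b by rewrite (inj_eq f_inj) adj_neq.
have <- : #|pr @: setX (S a) (S b)| = t ^ 2.
  rewrite card_imset ?cardsX ?cS //.
  by move=> [i j] [i' j'] /(blowup_edge_inj2 fab) /= [-> ->].
apply: subset_leq_card; apply/subsetP => _ /imsetP[[i j] + ->].
rewrite !inE /= => /andP[ia jb]; apply/andP; split; last by rewrite /pr baseE.
by have := lift_edgesP f S (pr (i, j)); rewrite inE => /rwP[+ _]; apply; exists a, b, i, j.
Qed.

(** * The hypergraph of canonical copies and its degrees *)

Definition canonical_family : {set {set {set blowup G n}}} :=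
  [set lift_edges p.1 p.2 | p in
     [set p : {ffun H -> G} * {ffun H -> {set 'I_n}} |
        injectiveb p.1 && [forall a, #|p.2 a| == t]]].

(** Prescribing an index at [a] and one at [b] costs a factor [t / n] each; every other vertex
    chooses freely among ['C(n, t)] sets. *)
Lemma card_draws_family (a b : H) (i j : 'I_n) : 0 < t -> a != b ->
  n ^ 2 * #|[set S : {ffun H -> {set 'I_n}} |
      [&& i \in S a, j \in S b & [forall c, #|S c| == t]]]| = t ^ 2 * 'C(n, t) ^ nv H.
Proof.
move=> t_gt0 ab.
have -> : #|[set S : {ffun H -> {set 'I_n}} |
      [&& i \in S a, j \in S b & [forall c, #|S c| == t]]]| =
    #|family (fun c : H => [pred s : {set 'I_n} |
       (#|s| == t) && (((c == a) ==> (i \in s)) && ((c == b) ==> (j \in s)))])|.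
  apply: eq_card => S; rewrite inE; apply/and3P/familyP => [[ia jb /forallP h] c|h].
    by rewrite !inE h /=; apply/andP; split; apply/implyP => /eqP ->.
  split; first by have := h a; rewrite !inE eqxx => /and3P[].
    by have := h b; rewrite !inE eqxx => /and3P[].
  by apply/forallP => c; have := h c; rewrite !inE => /and3P[].
rewrite card_family foldrE big_image /= (bigD1 a) //= (bigD1 b) /=; last by rewrite eq_sym.
rewrite (eq_bigr (fun=> 'C(n, t))); last first.
  move=> c /andP[ca cb]; have := card_draws 'I_n t; rewrite card_ord => <-.
  by apply: eq_card => s; rewrite !inE unfold_in (negbTE ca) (negbTE cb) /= andbT.
have ea : n * #|[pred s : {set 'I_n} | (#|s| == t) &&
    (((a == a) ==> (i \in s)) && ((a == b) ==> (j \in s)))]| = t * 'C(n, t).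
  rewrite -(card_draws_mem i t_gt0); congr (_ * _); apply: eq_card => s.
  by rewrite !inE eqxx (negbTE ab) /= andbT.
have eb : n * #|[pred s : {set 'I_n} | (#|s| == t) &&
    (((b == a) ==> (i \in s)) && ((b == b) ==> (j \in s)))]| = t * 'C(n, t).
  rewrite -(card_draws_mem j t_gt0); congr (_ * _); apply: eq_card => s.
  by rewrite !inE eqxx [b == a]eq_sym (negbTE ab).
have cE : nv H = #|[pred c : H | (c != a) && (c != b)]|.+2.
  rewrite /nv (cardD1 a) inE (cardD1 b) !inE eq_sym ab /= add1n add1n; congr _.+2.
  by apply: eq_card => c; rewrite !inE andbT andbC.
have E x y z : n * x = t * 'C(n, t) -> n * y = t * 'C(n, t) ->
    n ^ 2 * (x * (y * z)) = t ^ 2 * ('C(n, t) * ('C(n, t) * z)).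
  move=> ex ey; rewrite (_ : n ^ 2 * _ = (n * x) * (n * y) * z); last by ring.
  by rewrite ex ey; ring.
by rewrite prod_nat_const cE 2!(expnS 'C(n, t)); apply: E.
Qed.

Lemma canonical_family_degree (x : {set blowup G n}) : 0 < t ->
  n ^ 2 * #|[set F in canonical_family | x \in F]| <=
  #|G| ^ nv H * nv H ^ 2 * (t ^ 2 * 'C(n, t) ^ nv H).
Proof.
move=> t_gt0.
(* Any one hyperedge through [x] reveals the indices [i], [j] of the ends of [x], which all the
   others must contain too. *)
case: (set_0Vmem [set F in canonical_family | x \in F]) => [->|[F0]].
  by rewrite cards0 muln0.
rewrite !inE => /andP[/imsetP[[f0 S0] + ->]]; rewrite inE /= => /andP[/injectiveP f0_inj _].
case/lift_edgesP=> a0 [b0 [i [j [ab0 _ _ xE]]]].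
have fab0 : f0 a0 != f0 b0 by rewrite (inj_eq f0_inj) adj_neq.
pose W (p : H * H) := [set S : {ffun H -> {set 'I_n}} |
      [&& i \in S p.1, j \in S p.2 & [forall c, #|S c| == t]]].
(* An overcount suffices: all maps [f], and all [S] holding [i] and [j] at two distinct vertices of
   [H]. *)
pose Q : {set {ffun H -> G} * {ffun H -> {set 'I_n}}} :=
  setX setT (\bigcup_(p : H * H | p.1 != p.2) W p).
have sub : [set F in canonical_family | x \in F] \subset
    [set lift_edges p.1 p.2 | p in Q].
  apply/subsetP => F; rewrite inE => /andP[/imsetP[[f S] + ->]] /=.
  rewrite inE /= => /andP[/injectiveP f_inj cS] /lift_edgesP[a [b [i' [j' [ab ia jb xE']]]]].
  apply/imsetP; exists (f, S) => //; rewrite !inE /=; apply/bigcupP.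
  have := blowup_edge_inj fab0 (etrans (esym xE') xE).
  case=> -[iE jE]; [exists (a, b) | exists (b, a)] => //=;
    rewrite ?inE /= -?iE -?jE ?ia ?jb //.
  - exact: adj_neq.
  - by rewrite eq_sym adj_neq.
have leW : n ^ 2 * #|\bigcup_(p : H * H | p.1 != p.2) W p| <=
    nv H ^ 2 * (t ^ 2 * 'C(n, t) ^ nv H).
  apply: (@leq_trans (\sum_(p : H * H | p.1 != p.2) n ^ 2 * #|W p|)).
    elim/big_rec2: _ => [|p m A _ IH]; first by rewrite cards0 muln0.
    by rewrite (leq_trans (leq_mul (leqnn _) (leq_card_setU _ _).1)) // mulnDr leq_add2l.
  rewrite (eq_bigr (fun=> t ^ 2 * 'C(n, t) ^ nv H)) => [|p pn]; last exact: card_draws_family.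
  rewrite sum_nat_const leq_mul // (leq_trans (max_card _)) // card_prod mulnn //.
apply: leq_trans (leq_mul (leqnn _) (leq_trans (subset_leq_card sub) (leq_imset_card _ _))) _.
rewrite /Q cardsX cardsT card_ffun mulnCA -mulnA leq_mul //.
Qed.

Lemma ramsey_size_ge r : 0 < r -> 0 < nv H -> canonically_ramsey r G H t n -> t <= n.
Proof.
move=> r_gt0 /card_gt0P[a _] /(_ (fun=> Ordinal r_gt0))[K [/canonical_copy_lift_edges]].
by case=> f [S [_ cS _]] _; have := max_card (mem (S a)); rewrite cS card_ord.
Qed.

(** Were the inequality to fail, the degree bound would meet the colouring criterion and yield a
    colouring without monochromatic canonical copy. *)
Lemma ramsey_counting r :
    1 < r -> 0 < ne H -> 0 < t -> 0 < n -> canonically_ramsey r G H t n ->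
  r ^ (ne H * t ^ 2).-1 * n ^ 2 * t`! ^ nv H <
  4 * (ne H * t ^ 2) * (#|G| ^ nv H * nv H ^ 2) * t ^ 2 * n ^ (t * nv H).
Proof.
move=> r_gt1 e_gt0 t_gt0 n_gt0 ram; rewrite ltnNge; apply/negP => le.
have s_gt0 : 0 < ne H * t ^ 2 by rewrite muln_gt0 e_gt0 expn_gt0 t_gt0.
set s := (ne H * t ^ 2) in le s_gt0.
pose B := #|G| ^ nv H * nv H ^ 2 * (t ^ 2 * 'C(n, t) ^ nv H).
(* The factorials are cleared by ['C(n, t) * t! = n ^_ t <= n ^ t]. *)
have leB : 4 * s * B <= r ^ s.-1 * n ^ 2.
  have tf : 0 < t`! ^ nv H by rewrite expn_gt0 fact_gt0.
  rewrite -(leq_pmul2r tf) (leq_trans _ le) // /B -!mulnA -expnMn bin_ffact.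
  do 9!apply: leq_mul => //; rewrite expnM.
  by case: (nv H) => // k; rewrite leq_exp2r // ffact_le_exp.
(* The criterion wants hyperedges strictly larger than its parameter, hence [s.-1]. *)
have [] := @exists_proper_colouring_degree _ r canonical_family rat
  (B%:R / (n ^ 2)%:R)%R s.-1 r_gt1.
- rewrite prednK // mulrA ler_pdivrMr ?ltr0n ?expn_gt0 ?n_gt0 //.
  by rewrite -natrX -!natrM ler_nat.
- move=> _ /imsetP[[f S] + ->]; rewrite inE /= => /andP[/injectiveP f_inj /forallP cS].
  by rewrite prednK // card_lift_edges // => a; apply/eqP.
- move=> x; rewrite ler_pdivlMr ?ltr0n ?expn_gt0 ?n_gt0 // -natrM ler_nat mulnC.
  exact: canonical_family_degree.
move=> col proper_col.
have [K [/canonical_copy_lift_edges[f [S [f_inj cS KE]]] [c hc]]] := ram col.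
have /negP[] : ~~ mono col (sub_edges K).
  apply: proper_col; rewrite KE; apply/imsetP; exists (f, S) => //.
  by rewrite inE /=; apply/andP; split; [apply/injectiveP | apply/forallP => a; apply/eqP].
by apply/existsP; exists c; apply/forall_inP => e /hc ->.
Qed.

End CanonicalCopies.

(** * Asymptotics *)

(* Imported only here because the names and notations of [classical_sets] shadow
   those of [finset]. *)
From mathcomp Require Import all_classical all_reals all_analysis.
Import numFieldNormedType.Exports.

Local Open Scope classical_set_scope.
Local Open Scope ring_scope.

(** One term of the exponential series gives [t ^ t / t! <= e ^ t]; this weak Stirling bound is the
    source of [e ^ -1] in the theorem. *)
Lemma ln_fact_ge (R : realType) (t : nat) :
  (0 < t)%N -> t%:R * ln t%:R - t%:R <= ln (t`!%:R : R).
Proof.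
case: t => // t _; have t0 : 0 < t.+1%:R :> R by rewrite ltr0n.
have f0 : 0 < t.+1`!%:R :> R by rewrite ltr0n fact_gt0.
have := expR_ge1Dxn t (ltW t0); rewrite -lerBrDl => h.
have {}h : t.+1%:R ^+ t.+1 <= expR t.+1%:R * t.+1`!%:R :> R.
  by rewrite -ler_pdivrMr //; apply: le_trans h _; rewrite gerBl.
move: h; rewrite -ler_ln ?posrE ?exprn_gt0 ?mulr_gt0 ?expR_gt0 //.
by rewrite lnXn // lnM ?posrE ?expR_gt0 // expRK lerBlDl mulr_natl.
Qed.

(** This is [ln y <= y - 1] at [y = c * x]; small [c] makes the logarithm sublinear. *)
Lemma ln_le_linear (R : realType) (c x : R) :
  0 < c -> 0 < x -> ln x <= c * x - ln c.
Proof.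
move=> c0 x0; rewrite lerBrDr -lnM ?posrE // mulrC.
have := @le_ln1Dx R (c * x - 1); rewrite [1 + _]addrC subrK => h.
apply: le_trans (h _) _; last by rewrite gerBl.
by rewrite ltrBrDr addNr mulr_gt0.
Qed.

Lemma cvg_affine_ln_div (R : realType) (C : R) : 0 <= C ->
  ((C + 2 * ln t%:R) / t%:R : R) @[t --> \oo] --> (0 : R).
Proof.
move=> C0; apply/cvgr0Pnorm_le => e e0.
near=> t.
have t1 : 1 <= t%:R :> R by rewrite ler1n; near: t; apply: nbhs_infty_ge.
have t0 : 0 < t%:R :> R by apply: lt_le_trans t1.
have lt0 : 0 <= ln t%:R :> R by apply: ln_ge0.
rewrite ger0_norm; last by apply: divr_ge0; lra.
rewrite ler_pdivrMr //.
(* With slope [e / 4], [2 * ln t] uses half of [e * t]; the threshold on [t] fits the constants into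
   the other half. *)
have e4 : 0 < e / 4 by lra.
have lin := ln_le_linear e4 t0.
have : (C - 2 * ln (e / 4)) / (e / 2) <= t%:R by near: t; apply: nbhs_infty_ger.
rewrite ler_pdivrMr; lra.
Unshelve. all: by end_near.
Qed.

(* Here [N], [l], [L], [M] stand for the logarithms of [n], [t], [r] and of the
   constant factor, [E] for [e(H)], [k] for [v(H)] and [q] for [d(H) / v(H)]. *)
Lemma log_bound (R : realFieldType) (E k t L l M N q : R) :
    2 <= k -> 2 <= t -> 0 <= L -> 0 <= l -> 0 <= q -> 2 * E = q * k ^+ 2 ->
    (E * t ^+ 2 - 1) * L + 2 * N + k * (t * l - t) <= M + 4 * l + t * k * N ->
  q * L - 1 + l + q * k * t / 2 * L - (L + `|M| + 2 + 2 * l) / t <= N.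
Proof.
move=> k2 t2 L0 l0 q0 Eq h.
set X := q * L - 1 + l + q * k * t / 2 * L.
set Y := L + `|M| + 2 + 2 * l.
have leM : M <= `|M| by apply: ler_norm.
have M0 : 0 <= `|M| by apply: normr_ge0.
have Y0 : 0 <= Y by rewrite /Y; lra.
have t0 : 0 < t by lra.
have key : (k * t - 2) * (X - N) <= Y.
  (* Here [k * t * (q * L)] cancels against [-2] times [q * k * t / 2 * L]: the gain [q * L] comes
     from the exponent [k * t - 2] replacing [k * t]. *)
  have XE : (k * t - 2) * X = k * (t * l - t) + E * t ^+ 2 * L - 2 * l + 2 - 2 * (q * L).
    have -> : E = q * k ^+ 2 / 2 by rewrite -Eq; field.
    by rewrite /X; field.
  have qL : 0 <= q * L by apply: mulr_ge0.
  rewrite mulrBr XE /Y; lra.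
rewrite lerBlDr -lerBlDl ler_pdivlMr //.
(* If [X > N], then [key] suffices because [k * t - 2 >= t] for [k, t >= 2]. *)
have [XN|XN] := leP (X - N) 0; first by apply: le_trans Y0; rewrite pmulr_lle0.
apply: le_trans key; rewrite mulrC ler_pM2r //; nra.
Qed.

(** * The lower bound with an explicit error term *)

Definition log_const (R : realType) (G H : sgraph) : R :=
  ln (4 * (ne H)%:R * (#|G| ^ nv H * nv H ^ 2)%:R).

(** The remainder in [log_bound], of order [ln t / t]; [log_const] is the logarithm of the factor in
    [ramsey_counting] free of [t] and [n]. *)
Definition log_error (R : realType) (r : nat) (G H : sgraph) (t : nat) : R :=
  (ln r%:R + `|log_const R G H| + 2 + 2 * ln t%:R) / t%:R.

Lemma ramsey_lower_bound (R : realType) (r : nat) (G H : sgraph) (t n : nat) :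
    (2 <= r)%N -> (0 < nv H)%N -> (2 <= t)%N -> canonically_ramsey r G H t n ->
  expR (- log_error R r G H t) * ((r%:R `^ (avg_degree R H / (nv H)%:R)) * expR (- 1)) *
    t%:R * (r%:R `^ (avg_degree R H * t%:R / 2)) <= n%:R.
Proof.
move=> hr hH t2 ram; set d : R := avg_degree R H; set M := log_const R G H.
have tn : (t <= n)%N by apply: ramsey_size_ge ram => //; lia.
have t0 : 0 < t%:R :> R by rewrite ltr0n; lia.
have n0 : 0 < n%:R :> R by rewrite ltr0n; lia.
have rn0 : r%:R != 0 :> R by rewrite pnatr_eq0; lia.
have r0 : 0 < r%:R :> R by rewrite ltr0n; lia.
have k0 : 0 < (nv H)%:R :> R by rewrite ltr0n.
have L0 : 0 <= ln r%:R :> R by apply: ln_ge0; rewrite ler1n; lia.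
have l0 : 0 <= ln t%:R :> R by apply: ln_ge0; rewrite ler1n; lia.
have M0 : 0 <= `|M| by apply: normr_ge0.
have error_ge0 : 0 <= log_error R r G H t by rewrite divr_ge0 ?addr_ge0 ?mulr_ge0.
rewrite /powR (negbTE rn0) -{1}[t%:R](lnK (x := t%:R)) ?posrE //.
rewrite -[leRHS](lnK (x := n%:R)) ?posrE // -!expRD ler_expR.
(* Without edges [d = 0], and the claim follows from [t <= n]. *)
have [e0|e_gt0] := posnP (ne H).
  have -> : d = 0 by rewrite /d /avg_degree e0 mulr0 mul0r.
  have : ln t%:R <= ln n%:R :> R by rewrite ler_ln ?posrE // ler_nat.
  by rewrite !mul0r; lra.
have k2 : (2 <= nv H)%N.
  have [_ /edgesP[a [b [ab _]]]] := card_gt0P e_gt0.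
  by rewrite /nv (cardD1 a) inE (cardD1 b) !inE eq_sym adj_neq.
have count := ramsey_counting hr e_gt0 (ltnW t2) (leq_trans (ltnW t2) tn) ram.
have A_gt0 : (0 < #|G| ^ nv H * nv H ^ 2)%N.
  by rewrite lt0n; apply/eqP => A0; move: count; rewrite A0 muln0 !mul0n.
have e0 : 0 < (ne H)%:R :> R by rewrite ltr0n.
have A0 : 0 < (#|G| ^ nv H * nv H ^ 2)%:R :> R by rewrite ltr0n.
have f0 : 0 < t`!%:R :> R by rewrite ltr0n fact_gt0.
have s_gt0 : (0 < ne H * t ^ 2)%N by rewrite muln_gt0 e_gt0 expn_gt0 (ltnW t2).
have logs : ((ne H)%:R * t%:R ^+ 2 - 1) * ln r%:R + 2 * ln n%:R
      + (nv H)%:R * ln t`!%:R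
    <= M + 4 * ln t%:R + t%:R * (nv H)%:R * ln n%:R :> R.
  have : (r%:R ^+ (ne H * t ^ 2).-1 * n%:R ^+ 2 * t`!%:R ^+ nv H : R) <=
      4 * (ne H)%:R * (#|G| ^ nv H * nv H ^ 2)%:R * t%:R ^+ 4 * n%:R ^+ (t * nv H).
    rewrite -!natrX -!natrM ler_nat; apply: leq_trans (ltnW count) _.
    by apply: eq_leq; ring.
  rewrite /M /log_const; set m := 4 * _ * _; have m0 : 0 < m by rewrite !mulr_gt0.
  rewrite -ler_ln ?posrE ?mulr_gt0 ?exprn_gt0 //.
  rewrite !lnM ?posrE ?mulr_gt0 ?exprn_gt0 // !lnXn // -!(mulr_natl (ln _)).
  have -> : ((ne H * t ^ 2).-1)%:R = (ne H)%:R * t%:R ^+ 2 - 1 :> R.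
    by rewrite -natrX -natrM -[in RHS](prednK s_gt0) -natr1 addrK.
  by rewrite natrM; lra.
have k2R : 2 <= (nv H)%:R :> R by rewrite (ler_nat R 2).
have t2R : 2 <= t%:R :> R by rewrite (ler_nat R 2).
have bound := @log_bound R (ne H)%:R (nv H)%:R t%:R (ln r%:R) (ln t%:R) M (ln n%:R)
  (d / (nv H)%:R) k2R t2R L0 l0.
apply: le_trans (bound _ _ _).
- rewrite /log_error divfK ?gt_eqF //; lra.
- by rewrite /d /avg_degree !divr_ge0 ?mulr_ge0 ?ler0n.
- by rewrite /d /avg_degree; field; rewrite gt_eqF.
apply: le_trans logs; rewrite !lerD2l ler_pM2l //.
by apply: ln_fact_ge; apply: ltnW.
Qed.


Theorem theorem3p1 (R : realType) (r : nat) (G H : sgraph)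
    (hr : (2 <= r)%N) (hH : (0 < nv H)%N) :
  let d : R := avg_degree R H in
  exists eps : nat -> R,
    eps @ \oo --> (0 : R) /\
    \forall t \near \oo,
      (((1 + eps t) * ((r%:R `^ (d / (nv H)%:R)) * expR (- 1)) * t%:R
         * (r%:R `^ (d * t%:R / 2)))%:E
       <= blowup_ramsey R r G H t)%E.
Proof.
move=> d.
(* Chosen so that [1 + eps t] is exactly the error factor of [ramsey_lower_bound]. *)
exists (fun t => expR (- log_error R r G H t) - 1); split.
  have C0 : 0 <= ln r%:R + `|log_const R G H| + 2.
    by rewrite !addr_ge0 // ln_ge0 // ler1n ltnW.
  rewrite -[X in _ --> X](subrr (1 : R)); apply: cvgB; last exact: cvg_cst.
  rewrite -[X in _ --> X](@expR0 R) -oppr0.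
  apply: (@continuous_cvg _ _ _ _ _ (fun t => - log_error R r G H t) (@expR R)).
    exact: continuous_expR.
  by apply: cvgN; apply: cvg_affine_ln_div.
near=> t; rewrite [1 + _]addrC subrK /blowup_ramsey.
(* An infinite Ramsey number is trivial; otherwise the bound applies to the least canonically Ramsey
   [n]. *)
case: pselect => [ex|_]; last by rewrite leey.
case: ex_minnP => n /asboolP ram _; rewrite lee_fin.
by apply: ramsey_lower_bound => //; near: t; apply: nbhs_infty_ge.
Unshelve. all: by end_near.
Qed.
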